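(* Consider the family of power function distributions, with probability density functions $$p(x;\theta,\beta)=\theta\,\beta^{-\theta}x^{\theta-1},\qquad x\in(0,\beta],$$ parametrised by $(\theta,\beta)\in(0,\infty)\times(0,\infty)$. Its Fisher matrix is $$G(\theta,\beta)=\begin{pmatrix}\frac{1}{\theta^2}&0\\0&\frac{\theta^2}{\beta^2}\end{pmatrix},$$ and for all $(\theta_1,\beta_1),(\theta_2,\beta_2)\in(0,\infty)^2$ the Fisher--Rao distance is $$d_{\mathrm{FR}}\big((\theta_1,\beta_1),(\theta_2,\beta_2)\big)=2\,\mathrm{arctanh}\left(\sqrt{\frac{\big(\theta_1\theta_2\log(\beta_1/\beta_2)\big)^2+(\theta_1-\theta_2)^2}{\big(\theta_1\theta_2\log(\beta_1/\beta_2)\big)^2+(\theta_1+\theta_2)^2}}\right).$$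
   Context: For a parametric family $p_\xi=p(x;\xi)$ of probability densities with respect to Lebesgue measure, parametrised by $\xi$ in an open set $\Xi\subseteq\mathbb{R}^d$, the Fisher matrix is $G(\xi)=[g_{ij}(\xi)]$ with $g_{ij}(\xi)=\mathbb{E}_{p_\xi}\left[\frac{\partial\log p_\xi}{\partial\xi^i}\frac{\partial\log p_\xi}{\partial\xi^j}\right]$. For the power function family the support $(0,\beta]$ depends on the parameter; the Fisher matrix is still defined by this formula, with the expectation taken over the support and the derivatives those of $\log p(x;\theta,\beta)=\log\theta-\theta\log\beta+(\theta-1)\log x$ there. The Fisher--Rao distance $d_{\mathrm{FR}}(\xi_1,\xi_2)$ is the infimum of the lengths $\int_0^1\sqrt{\dot\xi(t)^{\mathsf T}G(\xi(t))\dot\xi(t)}\,\mathrm{d}t$ over piecewise differentiable curves $\xi:[0,1]\to\Xi$ with $\xi(0)=\xi_1$, $\xi(1)=\xi_2$. *)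

(* Defs.v *)
From HB Require Import structures.
From mathcomp Require Import all_boot all_order all_algebra.
From mathcomp Require Import all_classical all_reals all_analysis.

Set Implicit Arguments.
Unset Strict Implicit.
Unset Printing Implicit Defensive.

Import Order.TTheory GRing.Theory Num.Theory.
Import numFieldNormedType.Exports.

Local Open Scope classical_set_scope.
Local Open Scope ring_scope.

Section FisherRao.
Context {R : realType} {d : nat}.

(* A parametric family is given by its density formula [p xi x] together with
   the support [S xi]; the density is [p xi] on [S xi] and 0 elsewhere, and the
   formula itself is never evaluated outside the support in what follows. *)
Variables (p : 'rV[R]_d -> R -> R) (S : 'rV[R]_d -> set R).

(* The partial derivative acts on the parameter of the formula, with [x] fixed
   in the support of [p xi]: the dependence of [S] on the parameter plays no
   role. *)
Definition score (xi : 'rV[R]_d) (i : 'I_d) (x : R) : R :=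
  'D_(delta_mx 0 i) (fun z : 'rV[R]_d => ln (p z x)) xi.

Definition has_expectation (xi : 'rV[R]_d) (f : R -> R) : Prop :=
  lebesgue_measure.-integrable (S xi) (fun x => (f x * p xi x)%:E).

Definition expectation_at (xi : 'rV[R]_d) (f : R -> R) : R :=
  \int[lebesgue_measure]_(x in S xi) (f x * p xi x).

Definition fisher_mx (xi : 'rV[R]_d) : 'M[R]_d :=
  \matrix_(i, j) expectation_at xi (fun x => score xi i x * score xi j x).

(* Differentiability of the restriction of [c] to [a, b] at each of its points,
   one-sided at [a] and [b]. *)
Definition differentiable_on_itv (a b : R) (c : R -> 'rV[R]_d) : Prop :=
  forall t, t \in `[a, b] ->
    cvg ((fun u => (u - t)^-1 *: (c u - c t)) @ within [set` `[a, b]] t^').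

(* The pieces are closed intervals sharing their endpoints, so such a curve is
   continuous on [0, 1]. *)
Definition piecewise_differentiable (c : R -> 'rV[R]_d) : Prop :=
  exists2 s : seq R, itv_partition 0 1 s &
    forall i, (i < size s)%N ->
      differentiable_on_itv (nth 0 (0 :: s) i) (nth 0 s i) c.

(* Curves are total functions of which only the restriction to [0, 1] matters. *)
Definition curve_between (Xi : set 'rV[R]_d) (xi1 xi2 : 'rV[R]_d)
    (c : R -> 'rV[R]_d) : Prop :=
  [/\ piecewise_differentiable c,
      forall t, t \in `[0, 1] -> Xi (c t),
      c 0 = xi1 & c 1 = xi2].

(* [derive1 c t] is the velocity of the curve for all [t] in [0, 1] except finitely
   many (the breakpoints, 0 and 1), which do not affect the integral. The
   length may be [+oo]. *)
Definition fisher_length (c : R -> 'rV[R]_d) : \bar R :=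
  (\int[lebesgue_measure]_(t in `[0%R, 1%R])
     (Num.sqrt ((derive1 c t *m fisher_mx (c t) *m (derive1 c t)^T) 0 0))%:E)%E.

Definition fisher_rao_dist (Xi : set 'rV[R]_d) (xi1 xi2 : 'rV[R]_d) : \bar R :=
  ereal_inf [set fisher_length c | c in curve_between Xi xi1 xi2].

End FisherRao.

Section PowerFunction.
Context {R : realType}.

Definition vec2 (a b : R) : 'rV[R]_2 :=
  \row_(i < 2) if i == 0 then a else b.

(* The parameter (theta, beta) is the row vector with theta in position 0 and
   beta in position 1. *)
Definition powfun_param : set 'rV[R]_2 :=
  [set xi | 0 < xi 0 0 /\ 0 < xi 0 1].

Definition powfun_density (xi : 'rV[R]_2) (x : R) : R :=
  let theta := xi 0 0 in let beta := xi 0 1 in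
  theta * beta `^ (- theta) * x `^ (theta - 1).

Definition powfun_support (xi : 'rV[R]_2) : set R := `]0, xi 0 1].

(* Inverse of tanh, meaningful on ]-1, 1[ only. *)
Definition arctanh (x : R) : R := ln ((1 + x) / (1 - x)) / 2.

End PowerFunction.

(* Main.v *)
Require Import Defs.
From HB Require Import structures.
From mathcomp Require Import all_boot all_order all_algebra.
From mathcomp Require Import all_classical all_reals all_analysis.
From mathcomp Require Import measurable_realfun ring lra.
Set Implicit Arguments.
Unset Strict Implicit.
Unset Printing Implicit Defensive.

Import Order.TTheory GRing.Theory Num.Theory.
Import numFieldNormedType.Exports.
Local Open Scope classical_set_scope.
Local Open Scope ring_scope.

(** In the coordinates (x, y) = (ln beta, 1 / theta) the Fisher metric
    (dtheta / theta)^2 + (theta dbeta / beta)^2 is that of the upper half plane.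
    The distance is attained on vertical lines and on half circles. It is bounded
    below with the Busemann functions ln theta and
    ln (((ln beta - xi)^2 + y^2) / y), xi being an end point of the half circle
    through the two parameters: they have gradient of norm 1, so they vary along
    a curve by at most its length, and they vary by exactly the arc length along
    the geodesic.

    A merely differentiable curve need not have an integrable derivative, so the
    fundamental theorem of calculus is replaced by the inequality
    |f b - f a| <= \int |f'|, which holds as soon as f is continuous, and
    differentiable outside a finite set. *)

(** * Increments of differentiable functions *)

(** The integral of a nonnegative function is the supremum over the simple functions below it, so
    domination of the extensions by zero compares the integrals even of functions whose
    measurability has not been established, such as the integrand of [fisher_length]. *)
Lemma ge0_le_integralS d (T : measurableType d) (R : realType)
    (mu : {measure set T -> \bar R}) (A B : set T) (f g : T -> \bar R) :
  A `<=` B -> (forall x, A x -> 0 <= f x)%E -> (forall x, B x -> 0 <= g x)%E ->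
  (forall x, A x -> f x <= g x)%E ->
  (\int[mu]_(x in A) f x <= \int[mu]_(x in B) g x)%E.
Proof.
move=> AB f0 g0 fg.
have fA0 x : (0 <= (f \_ A) x)%E.
  by rewrite patchE; case: ifPn => // /set_mem/f0.
have gB0 x : (0 <= (g \_ B) x)%E.
  by rewrite patchE; case: ifPn => // /set_mem/g0.
rewrite integral_mkcond [leRHS]integral_mkcond.
rewrite !ge0_integralTE//.
apply: ereal_sup_le => _ [h /= hf <-]; exists h => //= x.
apply: le_trans (hf x) _; rewrite !patchE.
case: ifPn => [/set_mem Ax|_]; last exact: gB0.
by rewrite mem_set; [exact: fg|exact: AB].
Qed.

(** The derivative is the pointwise limit of the difference quotients with steps 1 / (m + 1), taken
    for the extension of [f] by zero, which is measurable on the whole line. *)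
Lemma open_measurable_derive1 (R : realType) (f : R -> R) (D : set R) :
  open D -> (forall t, D t -> derivable f t 1) -> measurable_fun D (derive1 f).
Proof.
move=> oD df.
have mD : measurable D by exact: open_measurable.
have mf : measurable_fun D f.
  apply: open_continuous_measurable_fun => // t /set_mem Dt.
  by apply: differentiable_continuous; exact/derivable1_diffP/df.
have mfD : measurable_fun setT (f \_ D) by exact/(measurable_restrictT f).
pose q (m : nat) (t : R) : R :=
  m.+1%:R * ((f \_ D) (m.+1%:R^-1 + t) - (f \_ D) t).
apply: (@measurable_fun_cvg _ _ _ D q) => [m|t Dt].
  apply: measurable_funTS; apply: measurable_funM => //.
  apply: measurable_funB => //; apply: measurableT_comp => //.
  exact: measurable_funD.
have := df _ Dt => /cvg_ex[l /= fl].
have -> : derive1 f t = l.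
  by rewrite derive1E /derive; apply/cvg_lim => //; exact: fl.
move/cvgr_dnbhsP : fl => /(_ (fun m => m.+1%:R^-1)) fl.
apply: cvg_trans (fl _); last first.
  by split; [move=> m; rewrite invr_eq0 pnatr_eq0|exact: cvg_harmonic].
(* As [D] is open, the shifted point lies in [D] for large [m], where the extension agrees with
   [f]. *)
apply: near_eq_cvg.
have : \forall m \near \oo, D ((m.+1%:R^-1 : R) + t).
  have h : ((m.+1%:R^-1 : R) + t) @[m --> \oo] --> 0 + t.
    by apply: cvgD; [exact: cvg_harmonic|exact: cvg_cst].
  by apply: h; rewrite add0r; exact: open_nbhs_nbhs.
apply: filterS => m Dm; rewrite /q !patchE !mem_set// invrK.
by rewrite /GRing.scale/= mulr1.
Qed.

(* Real induction: the supremum of the points where the inequality holds is [b]. *)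
Lemma local_increase_le (R : realType) (a b : R) (f : R -> R) (Phi : R -> \bar R) :
  a <= b -> {within `[a, b], continuous f} ->
  (forall x y, a <= x -> x <= y -> y <= b -> (Phi x <= Phi y)%E) ->
  (forall c, a <= c -> c < b -> exists2 e, 0 < e & forall y, c < y -> y < c + e ->
     y <= b -> (Phi c + (f y - f c)%:E <= Phi y)%E) ->
  (Phi a + (f b - f a)%:E <= Phi b)%E.
Proof.
move=> ab cf ndPhi loc.
pose P x := (Phi a + (f x - f a)%:E <= Phi x)%E.
pose S := [set x | a <= x <= b /\ P x].
have Sa : S a by split; rewrite ?lexx ?ab// /P subrr adde0.
have Sb : ubound S b by move=> x [/andP[]].
have hsS : has_sup S by split; [exists a|exists b].
pose c := sup S.
have ac : a <= c by apply: ub_le_sup => //; exists b.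
have cb : c <= b by apply: ge_sup => //; exists a.
(* The inequality passes to the supremum: [f] is continuous at [c], and monotonicity bounds [Phi x]
   by [Phi c] for the points [x] of [S] to the left. *)
have Pc : P c.
  apply/lee_addgt0Pr => e e0.
  have : cvg_to (fmap f (within `[a, b] (nbhs c))) (nbhs (f c)).
    by have /subspace_continuousP := cf; apply; rewrite /= in_itv/= ac cb.
  move=> /cvgrPdist_le/(_ e e0); rewrite near_withinE.
  move=> /nbhs_ballP[d /= d0 dP].
  have [x Sx cx] := sup_adherent d0 hsS; have [/andP[ax xb] Px] := Sx.
  have xc : x <= c by apply: ub_le_sup => //; exists b.
  have : `|f c - f x| <= e.
    apply: dP; last by rewrite /= in_itv/= ax xb.
    by rewrite /ball/= ger0_norm ?subr_ge0// ltrBlDr -ltrBlDl.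
  move=> /(le_trans (ler_norm _)) fcx.
  have -> : f c - f a = (f x - f a) + (f c - f x) by ring.
  rewrite EFinD addeA; apply: leeD; last by rewrite lee_fin.
  exact: le_trans Px (ndPhi _ _ _ _ _).
have [cb'|] := ltP c b; last first.
  by move=> bc; have <- : c = b by apply/eqP; rewrite eq_le cb bc.
(* If [c < b], the local hypothesis yields a point of [S] beyond its supremum. *)
have [e e0 eP] := loc _ ac cb'.
pose y := Num.min (c + e / 2) b.
have cy : c < y by rewrite lt_min cb' andbT; lra.
have yb : y <= b by rewrite ge_min lexx orbT.
have ye : y < c + e by rewrite gt_min; apply/orP; left; lra.
suff : S y by move=> /(ub_le_sup hsS.2); rewrite leNgt cy.
split; first by rewrite yb (le_trans ac (ltW cy)).
rewrite /P; have -> : f y - f a = (f c - f a) + (f y - f c) by ring.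
rewrite EFinD addeA; apply: le_trans (eP y cy ye yb).
exact: leeD.
Qed.

(* The value (k + 1) e on [V k] majorizes [h] near every point of [D]: this stands
   in for the lower semicontinuous majorant of the Vitali-Caratheodory theorem. *)
Lemma open_level_cover (R : realType) (D : set R) (h : R -> R) (e : R) :
  let mu := @lebesgue_measure R in
  measurable D -> (mu D < +oo)%E -> measurable_fun D h ->
  (forall t, D t -> 0 <= h t) -> 0 < e ->
  exists V : nat -> set R, [/\ forall k, open (V k),
    forall t, D t -> V (Num.truncn (h t / e)) t &
    (\sum_(0 <= k <oo) (k.+1%:R * e)%:E * mu (V k) <=
     \int[mu]_(t in D) (h t)%:E + e%:E * mu D + e%:E)%E].
Proof.
move=> mu mD Dfin mh h0 e0.
(* The level sets of [h] at scale [e] partition [D]; each [V k] will be an open set slightly larger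
   than [E k]. *)
pose E k := D `&` (h @^-1` `[k%:R * e, k.+1%:R * e[).
have mE k : measurable (E k) by apply: mh.
have Efin k : (mu (E k) < +oo)%E.
  apply: le_lt_trans Dfin; apply: le_measure; rewrite ?inE//.
    exact: mE.
  by move=> t [].
have EP t : D t -> E (Num.truncn (h t / e)) t.
  move=> Dt; split => //=; rewrite in_itv/=.
  have /andP[] := truncn_itv (divr_ge0 (h0 _ Dt) (ltW e0)).
  by rewrite ler_pdivlMr// ltr_pdivrMr// => -> ->.
have DE : D = \bigcup_k E k.
  apply/seteqP; split => [t Dt|t [k _ []//]].
  by exists (Num.truncn (h t / e)) => //; exact: EP.
have tE : trivIset setT E.
  apply/trivIsetP => i j _ _ ij; apply/seteqP; split => // t [[Dt + [_]]].
  rewrite /= !in_itv/= => /andP[i1 i2] /andP[j1 j2].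
  have ht n : n%:R * e <= h t -> h t < n.+1%:R * e -> Num.truncn (h t / e) = n.
    move=> k1 k2; apply: truncn_def.
    by rewrite ler_pdivlMr// ltr_pdivrMr// k1 k2.
  by case/eqP: ij; rewrite -(ht i i1 i2) (ht j j1 j2).
(* An excess of measure [del k], weighted by (k + 1) e, costs e / 2^(k+1), and these costs sum to
   [e]. *)
pose del k : R := (e / (2 ^ k.+1)%:R) / (k.+1%:R * e).
have ke0 k : 0 < k.+1%:R * e by rewrite mulr_gt0// ltr0n.
have del0 k : 0 < del k.
  by rewrite divr_gt0// divr_gt0// ltr0n expn_gt0.
have /choice[V VP] : forall k, exists U : set R,
    [/\ open U, E k `<=` U & (mu (U `\` E k) < (del k)%:E)%E].
  by move=> k; exact: lebesgue_regularity_outer.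
exists V; split.
- by move=> k; have [] := VP k.
- by move=> t /EP Et; have [_ + _] := VP (Num.truncn (h t / e)); exact.
have muD : mu D = (\sum_(0 <= k <oo) mu (E k))%E.
  rewrite {1}DE; apply: measure_semi_bigcup => //.
  exact: bigcupT_measurable.
have -> : (\int[mu]_(t in D) (h t)%:E =
    \sum_(0 <= k <oo) \int[mu]_(t in E k) (h t)%:E)%E.
  rewrite {1}DE; apply: ge0_integral_bigcup => //.
  by rewrite -DE; exact/measurable_EFinP.
  by rewrite -DE => t Dt; rewrite lee_fin h0.
rewrite muD -nneseriesZl//.
rewrite -nneseriesD//; last 2 first.
  move=> k _ _; apply: integral_ge0 => t [Dt _]; rewrite lee_fin h0//.
  by move=> k _ _; rewrite mule_ge0// lee_fin ltW.
apply: le_trans (epsilon_trick xpredT _ (ltW e0)); last first.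
  move=> k; apply: adde_ge0; last by rewrite mule_ge0// lee_fin ltW.
  by apply: integral_ge0 => t [Dt _]; rewrite lee_fin h0.
apply: lee_nneseries => [k _ _|k _].
  by rewrite mule_ge0// lee_fin ltW.
have [oV EV Vd] := VP k.
have mV : measurable (V k) by exact: measurable_realfun.open_measurable.
have -> : mu (V k) = (mu (E k) + mu (V k `\` E k))%E.
  rewrite -[in LHS](setDUK EV); apply: measureU => //.
  - exact: mE.
  - exact: measurableD mV (mE k).
  - by rewrite setDIK.
rewrite ge0_muleDr//; apply: leeD; last first.
  apply: (@le_trans _ _ ((k.+1%:R * e)%:E * (del k)%:E)%E).
    by rewrite lee_pmul2l ?fin_numE// ?lte_fin// ltW.
  by rewrite -EFinM lee_fin /del mulrC divfK ?gt_eqF.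
(* The weight splits as k e + e: the first part is below [h] on [E k], the second adds up to [e]
   times the measure of [D]. *)
rewrite -natr1 mulrDl mul1r EFinD ge0_muleDl ?lee_fin ?mulr_ge0 ?ler0n ?(ltW e0)//.
apply: leeD => //.
rewrite -integral_cst; last exact: mE.
apply: ge0_le_integralS => // t.
- by move=> _; rewrite lee_fin mulr_ge0 ?ler0n// ltW.
- by move=> [Dt _]; rewrite lee_fin h0.
- by move=> [_ /=]; rewrite in_itv/= lee_fin => /andP[].
Qed.

(** The increments of [f] are compared by real induction with those of [Phi], the weighted measure
    of the open cover [V] of the levels of |f'| to the left of [x], plus a jump [e] at each
    exceptional point. The total growth of [Phi] exceeds the integral by an arbitrarily small
    amount. *)
Lemma le_integral_norm_derive1 (R : realType) (f : R -> R) (a b : R) (s : seq R) :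
  a <= b -> {within `[a, b], continuous f} ->
  (forall t, t \in `]a, b[ -> t \notin s -> derivable f t 1) ->
  ((f b - f a)%:E <=
   \int[lebesgue_measure]_(t in `]a, b[ `\` [set` s]) `|derive1 f t|%:E)%E.
Proof.
move=> ab cf df; set D := _ `\` _.
pose mu := @lebesgue_measure R.
have oD : open D.
  rewrite /D setDE; apply: openI; first exact: interval_open.
  rewrite openC; apply: (accessible_finite_set_closed.1 _ _ (finite_seq s)).
  exact/hausdorff_accessible/Rhausdorff.
have mD : measurable D by exact: measurable_realfun.open_measurable.
have dfD t : D t -> derivable f t 1.
  by move=> [abt st]; apply: df => //; exact/negP.
have mdf := @open_measurable_derive1 _ _ _ oD dfD.
have muD : (mu D <= (b - a)%:E)%E.
  rewrite [leRHS](_ : _ = mu `]a, b[%classic); last first.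
    by rewrite /mu lebesgue_measure_itv/= lte_fin; case: ltP => // ba;
      have -> : a = b by [apply/eqP; rewrite eq_le ab ba]; rewrite subrr.
  by apply: le_measure; rewrite ?inE//; move=> t [].
have Dfin : (mu D < +oo)%E by exact: le_lt_trans muD (ltry _).
have mh : measurable_fun D (fun t => `|derive1 f t|).
  exact: measurableT_comp.
apply/lee_addgt0Pr => e' e'0.
(* The three terms pay for the rounding of |f'| up to a multiple of [e], for the excess measure of
   the cover, and for the jumps at [a] and at the points of [s]. *)
pose K : R := (b - a) + 1 + (size s).+1%:R.
have K0 : 0 < K by rewrite ltr_wpDl ?ltr0n// addr_ge0// subr_ge0.
pose e := e' / K; have e0 : 0 < e by rewrite divr_gt0.
have [V [oV VD VI]] :=
  open_level_cover mD Dfin mh (fun t _ => normr_ge0 _) e0.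
have mV k : measurable (V k) by exact: measurable_realfun.open_measurable.
pose mV' k (x y : R) := mu (V k `&` `]x, y]).
(* The point [a] is counted as exceptional too, since [f] is only known to be derivable inside the
   interval; the strict inequality places each jump just after its point. *)
pose N x : nat := count (fun y => y < x) (a :: s).
pose Phi x := (\sum_(0 <= k <oo) (k.+1%:R * e)%:E * mV' k a x + (e * (N x)%:R)%:E)%E.
have ke0 k : 0 <= k.+1%:R * e by rewrite mulr_ge0 ?ler0n// ltW.
have tge0 k x y : (0 <= (k.+1%:R * e)%:E * mV' k x y)%E.
  by apply: mule_ge0; [rewrite lee_fin|exact: measure_ge0].
have ser0 x : (0 <= \sum_(0 <= k <oo) (k.+1%:R * e)%:E * mV' k a x)%E.
  by apply: nneseries_ge0 => k _ _; exact: tge0.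
have N_nd x y : x <= y -> (N x <= N y)%N.
  by move=> xy; rewrite /N; apply: sub_count => z /= zx; exact: lt_le_trans xy.
have Vadd k x y : a <= x -> x <= y -> (mV' k a y = mV' k a x + mV' k x y)%E.
  move=> ax xy; rewrite /mV' -measureU//; first last.
  - rewrite setIACA setIid; apply/seteqP; split => // z /= [_ []].
    rewrite !in_itv/= => /andP[_ zx] /andP[xz _].
    by move: (lt_le_trans xz zx); rewrite ltxx.
  - by apply: measurableI; [exact: mV|exact: measurable_itv].
  - by apply: measurableI; [exact: mV|exact: measurable_itv].
  rewrite -setIUr; congr (mu (_ `&` _)); apply/seteqP; split => z /=.
    rewrite !in_itv/= => /andP[az zy]; rewrite az zy andbT.
    by case: (leP z x); [left|right].
  rewrite !in_itv/= => -[/andP[az zx]|/andP[xz zy]].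
    by rewrite az (le_trans zx xy).
  by rewrite zy (le_lt_trans ax xz).
have PhiD x y : a <= x -> x <= y -> (Phi y = Phi x +
    (\sum_(0 <= k <oo) (k.+1%:R * e)%:E * mV' k x y +
     (e * (N y - N x)%:R)%:E))%E.
  move=> ax xy; rewrite /Phi natrB ?N_nd// mulrBr EFinB.
  under eq_eseriesr do rewrite (Vadd _ x)// ge0_muleDr//.
  rewrite nneseriesD//.
  rewrite -[RHS]addeA [X in (_ = _ + X)%E]addeCA -addeA; congr (_ + (_ + _))%E.
  by rewrite -EFinB -EFinD subrKC.
have serxy0 x y : (0 <= \sum_(0 <= k <oo) (k.+1%:R * e)%:E * mV' k x y)%E.
  by apply: nneseries_ge0 => k _ _; exact: tge0.
have main : (Phi a + (f b - f a)%:E <= Phi b)%E.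
  apply: local_increase_le => //.
    move=> x y ax xy yb; rewrite (PhiD _ _ ax xy) leeDl// adde_ge0//.
    by rewrite lee_fin mulr_ge0// ltW.
  move=> c ac cb.
  (* At an exceptional point, continuity keeps the increase of [f] below [e], and the jump of [N]
     compensates it. *)
  have [cs|cs] := boolP (c \in a :: s).
    have : cvg_to (fmap f (within `[a, b] (nbhs c))) (nbhs (f c)).
      by have /subspace_continuousP := cf; apply; rewrite /= in_itv/= ac ltW.
    move=> /cvgrPdist_le/(_ e e0); rewrite near_withinE.
    move=> /nbhs_ballP[d /= d0 dP]; exists d => // y cy yd yb.
    rewrite (PhiD _ _ ac (ltW cy)); apply: leeD => //.
    apply: (@le_trans _ _ e%:E).
      rewrite lee_fin; apply: le_trans (ler_norm _) _; rewrite distrC; apply: dP.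
        by rewrite /ball/= distrC ger0_norm ?subr_ge0 ?(ltW cy)// ltrBlDl.
      by rewrite /= in_itv/= yb (le_trans ac (ltW cy)).
    rewrite -[leLHS]add0e; apply: leeD => //.
    rewrite lee_fin ler_peMr ?(ltW e0)// ler1n subn_gt0.
    (* The point [c] is counted by [N y] and not by [N c]. *)
    apply: (@leq_trans (N c + count_mem c (a :: s))).
      by rewrite -addn1 leq_add2l -has_count has_pred1.
    rewrite /N -count_predUI [X in (_ + X)%N](_ : _ = 0%N) ?addn0//.
      by apply: sub_count => z /= /orP[zc|/eqP->//]; exact: lt_trans zc cy.
    apply/eqP; rewrite -leqn0 leqNgt -has_count; apply/hasPn => z _ /=.
    by apply/negP => /andP[/lt_eqF ->].
  have Dc : D c.
    move: cs; rewrite in_cons negb_or => /andP[ca cs].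
    by split; [rewrite /= in_itv/= cb lt_neqAle eq_sym ca ac|exact/negP].
  (* At a point of derivability [f] grows at rate below (k + 1) e just after [c], while [V k]
     contains an interval around [c], so the single term of index [k] already makes [Phi] grow at
     that rate. *)
  set k := Num.truncn (`|derive1 f c| / e).
  have hk : `|derive1 f c| < k.+1%:R * e.
    by rewrite -ltr_pdivrMr//; exact: truncnS_gt.
  have := dfD _ Dc => /cvg_ex[l /= fl].
  have lE : derive1 f c = l.
    by rewrite derive1E /derive; apply/cvg_lim => //; exact: fl.
  have [_/posnumP[d] dP] : exists2 d, 0 < d & forall h, 0 < h -> h < d ->
      f (h + c) - f c <= k.+1%:R * e * h.
    have := cvgr_norm_lt _ fl; rewrite -lE => /(_ _ _ hk).
    rewrite near_withinE => /nbhs_ballP[d /= d0 dP]; exists d => // h h0 hd.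
    have := dP h; rewrite /ball/= sub0r normrN gtr0_norm// => /(_ hd).
    move=> /(_ (lt0r_neq0 h0)) /=; rewrite /GRing.scale/= mulr1 normrM.
    rewrite normfV (gtr0_norm h0) ltr_pdivrMl// => /ltW.
    by rewrite [h * _]mulrC; exact/le_trans/ler_norm.
  have := oV k; rewrite openE => /(_ c (VD _ Dc)) /nbhs_ballP[d' /= d'0 d'P].
  exists (Num.min d%:num d'); first by rewrite lt_min d'0 gt0.
  move=> y cy; rewrite -ltrBlDl lt_min => /andP[yd yd'] yb.
  rewrite (PhiD _ _ ac (ltW cy)); apply: leeD => //.
  apply: (@le_trans _ _ (k.+1%:R * e * (y - c))%:E).
    by rewrite lee_fin; have := dP (y - c); rewrite subrK; apply => //; rewrite subr_gt0.
  rewrite -[leLHS]adde0; apply: leeD; last by rewrite lee_fin mulr_ge0// ltW.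
  rewrite (nneseriesD1 (n := k))//.
  rewrite -[leLHS]adde0; apply: leeD; last first.
    by apply: nneseries_ge0 => ? _ _; exact: tge0.
  rewrite EFinM; apply: lee_wpmul2l; first by rewrite lee_fin.
  rewrite /mV' setIidr; last first.
    move=> z /=; rewrite in_itv/= => /andP[cz zy]; apply: d'P.
    rewrite /ball/= distrC gtr0_norm ?subr_gt0//.
    by rewrite (le_lt_trans _ yd')// lerB.
  by rewrite /mu lebesgue_measure_itv/= lte_fin cy -EFinB.
apply: (@le_trans _ _ (Phi b)).
  apply: le_trans main; rewrite -[leLHS]add0e; apply: leeD => //.
  by rewrite adde_ge0// lee_fin mulr_ge0// ltW.
have -> : e' = e * (b - a) + e + e * (size s).+1%:R.
  rewrite -{1}(divfK (lt0r_neq0 K0) e') -/e /K; ring.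
rewrite !EFinD !addeA; apply: leeD; last first.
  by rewrite lee_fin ler_pM2l// ler_nat count_size.
apply: le_trans (le_trans VI _).
  apply: lee_nneseries => [k _ _|k _]; first by exact: tge0.
  apply: lee_wpmul2l; first by rewrite lee_fin.
  apply: le_measure; rewrite ?inE; last exact: subIsetl.
    by apply: measurableI; [exact: mV|exact: measurable_itv].
  exact: mV.
apply: leeD => //; apply: leeD => //.
by rewrite (EFinM e (b - a)); apply: lee_wpmul2l; rewrite ?lee_fin ?(ltW e0).
Qed.

(** * Piecewise differentiable curves *)

(** Near [t] the difference quotients are bounded by [|l| + 1], which gives a Lipschitz estimate at
    [t]. *)
Lemma differentiable_on_itv_continuous (R : realType) (d : nat) (a b : R)
    (c : R -> 'rV[R]_d) :
  differentiable_on_itv a b c -> {within `[a, b], continuous c}.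
Proof.
move=> dc; apply/subspace_continuousP => t abt.
have /cvg_ex[/= l cl] := dc t abt.
apply/cvgrPdist_le => e e0.
have := cvgr_norm_le _ cl _ (ltr_pwDr ltr01 (lexx `|l|)).
move=> /(_ (within_filter _ _)); rewrite !near_withinE => /nbhs_ballP[r /= r0 rP].
have l0 : 0 < `|l| + 1 by rewrite ltr_wpDl.
apply/nbhs_ballP; exists (Num.min r (e / (`|l| + 1))) => /=.
  by rewrite lt_min r0 divr_gt0.
move=> u tu abu; have [->|ut] := eqVneq u t.
  by rewrite subrr normr0 ltW.
move: tu; rewrite /ball/= lt_min => /andP[tur tue].
have := rP u tur ut abu; rewrite normrZ normfV ler_pdivrMl; last first.
  by rewrite normr_gt0 subr_eq0.
rewrite distrC => /le_trans; apply.
by rewrite distrC -ler_pdivlMr// ltW.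
Qed.

Lemma differentiable_on_itv_derivable (R : realType) (d : nat) (a b : R)
    (c : R -> 'rV[R]_d) (t : R) :
  differentiable_on_itv a b c -> t \in `]a, b[ -> derivable c t 1.
Proof.
move=> dc abt; have /dc/cvg_ex[/= l cl] : t \in `[a, b].
  exact: subset_itv_oo_cc abt.
apply/cvg_ex; exists l; apply/cvgrPdist_le => e e0.
have := cl => /cvgrPdist_le /(_ e e0).
rewrite !near_withinE => H.
have : \forall u \near t, [set` `]a, b[] u.
  by apply: open_nbhs_nbhs; split => //; exact: interval_open.
move: H => /filterI /[apply] /nbhs_ballP[r /= r0 rP].
apply/nbhs_ballP; exists r => //= h; rewrite /ball/= sub0r normrN => hr h0.
have [|+ abh] := rP (h + t); first by rewrite /ball/= opprD addrCA subrr addr0 normrN.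
rewrite /= /GRing.scale/= mulr1 addrK; apply; last exact: subset_itv_oo_cc abh.
by rewrite -subr_eq0 addrK.
Qed.

(** Induction on the partition with its left end generalized: continuity is glued along closed
    intervals sharing an end point, and the exceptional points are the breakpoints. *)
Lemma piecewise_differentiable_continuous (R : realType) (d : nat)
    (c : R -> 'rV[R]_d) :
  piecewise_differentiable c -> {within `[0, 1], continuous c} /\
    exists s : seq R, forall t, t \in `]0, 1[ -> t \notin s -> derivable c t 1.
Proof.
move=> [s [p01 /eqP l01] dc].
suff H : forall (s : seq R) a, path <%O a s ->
    (forall i, (i < size s)%N ->
       differentiable_on_itv (nth 0 (a :: s) i) (nth 0 s i) c) ->
    {within `[a, last a s], continuous c} /\
    forall t, t \in `]a, last a s[ -> t \notin s -> derivable c t 1.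
  by have [cc dc'] := H _ _ p01 dc; rewrite l01 in cc dc'; split => //; exists s.
move=> {dc l01 p01} {}s.
elim: s => [a _ _|b s IH a /= /andP[ab pbs] dc].
  split => [/=|t]; first by rewrite set_itv1; exact: continuous_subspace1.
  by rewrite in_itv/= => /andP[/lt_trans /[apply]]; rewrite ltxx.
have [cb db] := IH b pbs (fun i => dc i.+1).
have d0 := dc 0 isT; have bl : b <= last b s.
  exact: (@itv_partition_le _ _ b _ s).
split.
  have -> : `[a, last b s]%classic = `[a, b] `|` `[b, last b s] :> set R.
    apply/seteqP; split => t /=; rewrite !in_itv/=.
      by move=> /andP[-> ->]; rewrite andbT; case: (leP t b) => [|/ltW]; [left|right].
    move=> [/andP[-> tb]|/andP[bt ->]]; first by rewrite (le_trans tb).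
    by rewrite (le_trans (ltW ab)).
  apply: withinU_continuous => //; [exact: interval_closed..|].
  exact: differentiable_on_itv_continuous d0.
move=> t; rewrite in_itv/= in_cons negb_or => /andP[at' tl] /andP[tb ts].
move: tb; rewrite neq_lt => /orP[tb|bt].
  by apply: differentiable_on_itv_derivable d0 _; rewrite in_itv/= at'.
by apply: db => //; rewrite in_itv/= bt.
Qed.

(** * The Fisher matrix *)

(** Improper form of the fundamental theorem of calculus: it is applied on the intervals from [u n]
    to [b], which exhaust the domain, and monotone convergence gives the limit. The sequence is
    geometric so that ln (u n / b) is the integer - (n + 1). *)
Lemma ge0_integral_oc_antiderivative (R : realType) (g G : R -> R) (b : R) :
  0 < b -> (forall x : R, 0 < x -> 0 <= g x) ->
  (forall x : R, 0 < x -> {for x, continuous g}) ->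
  (forall x : R, 0 < x -> is_derive x 1 G (g x)) ->
  G (b * expR (- n.+1%:R)) @[n --> \oo] --> 0 ->
  lebesgue_measure.-integrable `]0, b] (EFin \o g) /\
  \int[lebesgue_measure]_(x in `]0, b]) g x = G b.
Proof.
move=> b0 g0 cg dG G0.
pose mu := @lebesgue_measure R.
pose u (n : nat) : R := b * expR (- n.+1%:R).
have u0 n : 0 < u n by rewrite mulr_gt0// expR_gt0.
have ub n : u n < b.
  by rewrite gtr_pMr// -[ltRHS]expR0 ltr_expR oppr_lt0 ltr0n.
have und m n : (m <= n)%N -> u n <= u m.
  by move=> mn; rewrite ler_pM2l// ler_expR lerN2 ler_nat.
have cG x : 0 < x -> {for x, continuous G}.
  move=> /dG [/derivable1_diffP dGx _]; exact: differentiable_continuous.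
have mg : measurable_fun (`]0, b] : set R) g.
  have mgy : measurable_fun (`]0, +oo[ : set R) g.
    apply: open_continuous_measurable_fun; first exact: interval_open.
    by move=> x; rewrite inE/= in_itv/= andbT; exact: cg.
  apply: measurable_funS mgy => // x /=.
  by rewrite !in_itv/= => /andP[->].
have ftc n : (\int[mu]_(x in `[u n, b]) (g x)%:E = (G b - G (u n))%:E)%E.
  rewrite EFinB; apply: continuous_FTC2 => //.
  - apply: continuous_in_subspaceT => x; rewrite inE/= in_itv/= => /andP[ux _].
    exact/cg/(lt_le_trans (u0 n)).
  - split.
    + move=> x; rewrite in_itv/= => /andP[ux _].
      by have [] := dG _ (lt_trans (u0 n) ux).
    + by apply: cvg_at_right_filter; exact: cG.
    + by apply: cvg_at_left_filter; exact: cG.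
  - move=> x; rewrite in_itv/= => /andP[ux _].
    by rewrite derive1E; have /= [_ ->] := dG _ (lt_trans (u0 n) ux).
have UE : `]0, b]%classic = \bigcup_n `[u n, b]%classic.
  apply/seteqP; split => x /=; last first.
    by move=> [n _] /=; rewrite !in_itv/= => /andP[/(lt_le_trans (u0 n)) -> ->].
  rewrite in_itv/= => /andP[x0 xb].
  exists (Num.truncn `|ln (x / b)|) => //=; rewrite in_itv/= xb andbT.
  rewrite /u [b * _]mulrC -ler_pdivlMr// -[leRHS]lnK ?posrE ?divr_gt0// ler_expR.
  rewrite lerNl; apply: le_trans (ltW (truncnS_gt _)).
  by rewrite -normrN ler_norm.
have IE : (\int[mu]_(x in `]0%R, b]) (g x)%:E = (G b)%:E)%E.
  have : (\int[mu]_(x in `[u n, b]) (g x)%:E)%E @[n --> \oo] -->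
      (\int[mu]_(x in `]0%R, b]) (g x)%:E)%E.
    rewrite UE; apply: ge0_nondecreasing_set_cvg_integral => //.
    - move=> m n mn; apply/subsetPset => x /=; rewrite !in_itv/=.
      by move=> /andP[/(le_trans (und _ _ mn)) -> ->].
    - move=> n; apply/measurable_EFinP; apply: measurable_funS mg => // x /=.
      by rewrite !in_itv/= => /andP[/(lt_le_trans (u0 n)) -> ->].
    - move=> n x /=; rewrite in_itv/= lee_fin => /andP[ux _].
      exact/g0/(lt_le_trans (u0 n)).
  under eq_fun do rewrite ftc.
  move=> /cvg_lim <-//; apply/cvg_lim => //.
  apply: cvg_EFin; first exact: nearW.
  rewrite -[X in _ --> X]subr0; apply: cvgB; [exact: cvg_cst|exact: G0].
split; last by rewrite /Rintegral IE.
apply/integrableP; split; first exact/measurable_EFinP.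
under eq_integral => x.
  rewrite inE/= in_itv/= => /andP[x0 _].
  rewrite ger0_norm ?g0//; over.
by rewrite IE ltry.
Qed.

(** Since exp y is at least y^3 / 6 for nonnegative y, the product is O(1 / (n + 1)). *)
Lemma cvg_quadratic_expR (R : realType) (theta a b c : R) : 0 < theta ->
  (a + b * n.+1%:R + c * n.+1%:R ^+ 2) * expR (- (theta * n.+1%:R)) @[n --> \oo]
    --> (0 : R).
Proof.
move=> th0; pose K := (`|a| + `|b| + `|c|) * (6 / theta ^+ 3).
have K1 : K * n.+1%:R^-1 @[n --> \oo] --> (0 : R).
  rewrite -[X in _ --> X](mulr0 K); apply: cvgM; first exact: cvg_cst.
  exact: cvg_harmonic.
apply/norm_cvg0P; apply: (squeeze_cvgr _ (@cvg_cst _ _ _ _ _) K1).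
apply: nearW => n; rewrite normr_ge0/=.
set m : R := n.+1%:R; have m1 : 1 <= m by rewrite ler1n.
have m0 : 0 < m by exact: lt_le_trans m1.
rewrite normrM [X in _ * X]gtr0_norm ?expR_gt0//.
have -> : K / m = ((`|a| + `|b| + `|c|) * m ^+ 2) * (6 / (theta * m) ^+ 3).
  by rewrite /K; field; rewrite !gt_eqF.
apply: ler_pM => //.
  apply: le_trans (ler_normD _ _) _; rewrite 2!mulrDl; apply: lerD.
    apply: le_trans (ler_normD _ _) _; apply: lerD.
      by rewrite ler_peMr// exprn_ege1.
    by rewrite normrM (gtr0_norm m0) ler_wpM2l// expr2 ler_peMr// ltW.
  by rewrite normrM (gtr0_norm (exprn_gt0 2 m0)).
rewrite expRN -[6 / _]invf_div lef_pV2 ?posrE ?expR_gt0//; last first.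
  by rewrite divr_gt0// exprn_gt0// mulr_gt0.
apply: le_trans (expR_ge1Dxn 2 (ltW (mulr_gt0 th0 m0))).
by rewrite (_ : 3`! = 6)%N// lerDr.
Qed.

Lemma vec2E0 (R : realType) (a b : R) : vec2 a b 0 0 = a.
Proof. by rewrite /vec2 mxE eqxx. Qed.

Lemma vec2E1 (R : realType) (a b : R) : vec2 a b 0 1 = b.
Proof. by rewrite /vec2 mxE. Qed.

(** Exponential form of the density, whose logarithm and antiderivatives are explicit. *)
Lemma powfun_densityE (R : realType) (xi : 'rV[R]_2) (x : R) :
  0 < xi 0 1 -> 0 < x ->
  powfun_density xi x =
  xi 0 0 / x * expR (xi 0 0 * (ln x - ln (xi 0 1))).
Proof.
move=> b0 x0; rewrite /powfun_density /powR !gt_eqF//.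
rewrite -mulrA -expRD -mulrA; congr (_ * _).
rewrite -[x^-1 in RHS]lnK ?posrE ?invr_gt0// lnV ?posrE// -expRD.
by congr expR; ring.
Qed.

(** * Scores and their moments *)

Section Moments.
Context {R : realType}.
Variables (theta beta : R).
Hypotheses (theta0 : 0 < theta) (beta0 : 0 < beta).

(** Here [s] is the score in the direction of theta, and [p] the density on the support. *)
Let s (x : R) := theta^-1 + (ln x - ln beta).
Let p (x : R) := theta / x * expR (theta * (ln x - ln beta)).

(** With L = ln x - ln beta one has p dx = theta exp(theta L) dL, so a quadratic polynomial in [s]
    times [p] has a primitive of the form quadratic polynomial in L times exp(theta L). At [beta],
    where L = 0, it equals a + c / theta^2. *)
Let antiderivative (a b c x : R) : R :=
  (a + b * (ln x - ln beta) + c * ((ln x - ln beta) ^+ 2 + theta ^- 2)) *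
  expR (theta * (ln x - ln beta)).

Let is_derive_antiderivative (a b c x : R) : 0 < x ->
  is_derive x 1 (antiderivative a b c) ((a + b * s x + c * s x ^+ 2) * p x).
Proof.
move=> x0.
pose q (L : R) : R := (a + b * L + c * (L ^+ 2 + theta ^- 2)) * expR (theta * L).
have dL : is_derive x (1:R) (fun x : R => ln x - ln beta) x^-1.
  have := is_derive1_ln x0 => dln.
  apply: is_derive_eq; by rewrite subr0.
set L := ln x - ln beta.
have dq : is_derive L 1 q ((b + c * (2 * L)) * expR (theta * L) +
   (a + b * L + c * (L ^+ 2 + theta ^- 2)) * (theta * expR (theta * L))).
  have dE : is_derive L 1 (fun L => expR (theta * L)) (theta * expR (theta * L)).
    rewrite mulrC; apply: is_derive1_comp.
    by apply: is_derive_eq; rewrite /GRing.scale/= mulr1.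
  apply: is_derive_eq; rewrite /GRing.scale/=; ring.
have := @is_derive1_comp R q (fun x => ln x - ln beta) x _ _ dq dL.
congr (is_derive _ _ _ _).
by rewrite /s /p -/L; field; rewrite !gt_eqF.
Qed.

Lemma powfun_moment_ge0 (a b c : R) :
  (forall x, 0 <= a + b * s x + c * s x ^+ 2) ->
  lebesgue_measure.-integrable `]0, beta]
    (EFin \o (fun x => (a + b * s x + c * s x ^+ 2) * p x)) /\
  \int[lebesgue_measure]_(x in `]0, beta]) ((a + b * s x + c * s x ^+ 2) * p x)
    = a + c / theta ^+ 2.
Proof.
move=> ge0.
have <- : antiderivative a b c beta = a + c / theta ^+ 2.
  by rewrite /antiderivative subrr !mulr0 expR0 expr2 mul0r add0r addr0 mulr1.
apply: ge0_integral_oc_antiderivative => //.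
- move=> x x0; rewrite mulr_ge0// mulr_ge0 ?expR_ge0// divr_ge0// ltW//.
- move=> x x0; have cln : ln y @[y --> x] --> ln x by exact: continuous_ln.
  have cL : ln y - ln beta @[y --> x] --> ln x - ln beta.
    by apply: cvgB cln _; exact: cvg_cst.
  have cs : s y @[y --> x] --> s x by apply: cvgD cL; exact: cvg_cst.
  have cp : p y @[y --> x] --> p x.
    apply: cvgM.
      by apply: cvgM; [exact: cvg_cst|apply: cvgV; [rewrite gt_eqF|exact: cvg_id]].
    apply: continuous_cvg; first exact: continuous_expR.
    by apply: cvgM cL; exact: cvg_cst.
  apply: cvgM cp; apply: cvgD; [apply: cvgD|].
  - exact: cvg_cst.
  - by apply: cvgM cs; exact: cvg_cst.
  - by apply: cvgM; [exact: cvg_cst|rewrite expr2; apply: cvgM].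
- by move=> x; exact: is_derive_antiderivative.
(* Along the exhausting sequence L = - (n + 1), whence the sign of [b]. *)
apply: cvg_trans (cvg_quadratic_expR (a + c / theta ^+ 2) (- b) c theta0).
apply: near_eq_cvg; apply: nearW => n.
rewrite /antiderivative lnM ?posrE ?expR_gt0// expRK.
have -> : ln beta + - n.+1%:R - ln beta = - n.+1%:R by rewrite addrAC subrr add0r.
by move: (n.+1%:R : R) => m; congr (_ * _); [ring|rewrite mulrN].
Qed.

End Moments.

(** As the score in beta is a constant, the Fisher matrix only involves the moments of order 0, 1
    and 2 of the score in theta. *)
Lemma powfun_score_moments (R : realType) (theta beta : R) :
  0 < theta -> 0 < beta ->
  let s (x : R) := theta^-1 + (ln x - ln beta) in
  let p (x : R) := theta / x * expR (theta * (ln x - ln beta)) in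
  [/\ lebesgue_measure.-integrable `]0, beta] (EFin \o p),
      lebesgue_measure.-integrable `]0, beta] (EFin \o (fun x => s x * p x)) &
      lebesgue_measure.-integrable `]0, beta] (EFin \o (fun x => s x ^+ 2 * p x))] /\
  [/\ \int[lebesgue_measure]_(x in `]0, beta]) p x = 1,
      \int[lebesgue_measure]_(x in `]0, beta]) (s x * p x) = 0 &
      \int[lebesgue_measure]_(x in `]0, beta]) (s x ^+ 2 * p x) = 1 / theta ^+ 2].
Proof.
move=> th0 b0 s p.
have moment (a b c : R) (f : R -> R) :
    (forall x, f x = (a + b * s x + c * s x ^+ 2) * p x) ->
    (forall y : R, 0 <= a + b * y + c * y ^+ 2) ->
    lebesgue_measure.-integrable `]0, beta] (EFin \o f) /\
    \int[lebesgue_measure]_(x in `]0, beta]) f x = a + c / theta ^+ 2.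
  by move=> /funext -> abc; apply: powfun_moment_ge0 => // x; exact: abc.
have [x||i0 j0] := moment 1 0 0 p; [ring|by move=> y; rewrite !mul0r !addr0|].
have [x||i2 j2] := moment 0 0 1 (fun x => s x ^+ 2 * p x).
- ring.
- by move=> y; rewrite !mul0r !add0r mul1r sqr_ge0.
have [x||i3 j3] := moment 1 2 1 (fun x => (1 + s x) ^+ 2 * p x).
- ring.
- move=> y; have -> : 1 + 2 * y + 1 * y ^+ 2 = (1 + y) ^+ 2 by ring.
  exact: sqr_ge0.
(* The score changes sign, so its moments come by polarization of nonnegative ones. *)
have sE : (fun x => s x * p x) =
    (fun x => 2^-1 * (((1 + s x) ^+ 2 * p x - p x) - s x ^+ 2 * p x)).
  by apply/funext => x; field.
have mI : measurable (`]0, beta]%classic : set (measurableTypeR R)).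
  exact: measurable_itv.
have i4 : lebesgue_measure.-integrable `]0, beta]
    (EFin \o (fun x => (1 + s x) ^+ 2 * p x - p x)).
  by have := integrableB mI i3 i0.
have i5 : lebesgue_measure.-integrable `]0, beta]
    (EFin \o (fun x => ((1 + s x) ^+ 2 * p x - p x) - s x ^+ 2 * p x)).
  by have := integrableB mI i4 i2.
have i1 : lebesgue_measure.-integrable `]0, beta] (EFin \o (fun x => s x * p x)).
  by rewrite sE; have := integrableZl mI (2^-1) i5.
split; split => //.
- by rewrite j0 mul0r addr0.
- by rewrite sE RintegralZl// RintegralB// RintegralB// j0 j2 j3; ring.
- by rewrite j2 add0r.
Qed.

(** Allows a partial derivative to be computed from a closed form [phi] valid only for small [h],
    while the perturbed parameter stays positive. *)
Lemma derive_along_line (R : realType) (n : nat) (f : 'rV[R]_n -> R) (xi v : 'rV[R]_n)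
    (phi : R -> R) (l : R) :
  (\forall h \near 0, phi h = f (h *: v + xi)) -> is_derive (0 : R) 1 phi l ->
  'D_v f xi = l.
Proof.
move=> phiE [dphi <-].
have := @near_eq_derive _ _ _ phi (fun h => f (h *: v + xi)) 0 1 phiE.
rewrite /derive => ->.
apply: congr1; apply: congr2 => //; apply/funext => h /=.
by rewrite scale0r add0r addr0 /GRing.scale/= mulr1.
Qed.

Lemma powfun_score0 (R : realType) (theta beta x : R) :
  0 < theta -> 0 < beta -> 0 < x ->
  score powfun_density (vec2 theta beta) 0 x = theta^-1 + (ln x - ln beta).
Proof.
move=> th0 b0 x0.
pose phi (h : R) := ln (h + theta) - ln x + (h + theta) * (ln x - ln beta).
apply: (@derive_along_line _ _ _ _ _ phi).
  have : \forall h \near (0 : R), 0 < h + theta.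
    have : (h + theta) @[h --> (0 : R)] --> 0 + theta.
      by apply: cvgD; [exact: cvg_id|exact: cvg_cst].
    by rewrite add0r => /cvgr_gt; apply.
  apply: filterS => h h0; set xi := _ + _.
  have xi0 : xi 0 0 = h + theta by rewrite !mxE/= mulr1.
  have xi1 : xi 0 1 = beta by rewrite !mxE/= mulr0 add0r.
  rewrite powfun_densityE ?xi1// xi0 lnM ?posrE ?expR_gt0 ?divr_gt0// expRK.
  by rewrite ln_div ?posrE.
have dln : is_derive (0 : R) 1 (fun h => ln (h + theta)) theta^-1.
  rewrite -[theta^-1]mulr1.
  apply: (@is_derive1_comp R (@ln R) (fun h => h + theta)).
    by rewrite add0r; exact: is_derive1_ln.
  by apply: is_derive_eq; rewrite addr0.
apply: is_derive_eq; rewrite /GRing.scale/=; ring.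
Qed.

Lemma powfun_score1 (R : realType) (theta beta x : R) :
  0 < theta -> 0 < beta -> 0 < x ->
  score powfun_density (vec2 theta beta) 1 x = - (theta / beta).
Proof.
move=> th0 b0 x0.
(* The logarithm of the density formula at parameter (theta, h + beta), with [x] fixed, even if [x]
   exceeds h + beta. *)
pose phi (h : R) := ln theta - ln x + theta * (ln x - ln (h + beta)).
apply: (@derive_along_line _ _ _ _ _ phi).
  have : \forall h \near (0 : R), 0 < h + beta.
    have : (h + beta) @[h --> (0 : R)] --> 0 + beta.
      by apply: cvgD; [exact: cvg_id|exact: cvg_cst].
    by rewrite add0r => /cvgr_gt; apply.
  apply: filterS => h h0; set xi := _ + _.
  have xi0 : xi 0 0 = theta by rewrite !mxE/= mulr0 add0r.
  have xi1 : xi 0 1 = h + beta by rewrite !mxE/= mulr1.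
  rewrite powfun_densityE ?xi1// xi0 lnM ?posrE ?expR_gt0 ?divr_gt0// expRK.
  by rewrite ln_div ?posrE.
have dln : is_derive (0 : R) 1 (fun h => ln (h + beta)) beta^-1.
  rewrite -[beta^-1]mulr1.
  apply: (@is_derive1_comp R (@ln R) (fun h => h + beta)).
    by rewrite add0r; exact: is_derive1_ln.
  by apply: is_derive_eq; rewrite addr0.
apply: is_derive_eq; rewrite /GRing.scale/=; ring.
Qed.

Lemma ord2P (i : 'I_2) : i = 0 \/ i = 1.
Proof. by case: i => [[|[|//]]] ?; [left|right]; exact: val_inj. Qed.

(** The second score is the constant k = - theta / beta, so the entries are the second moment of
    [s], [k] times its mean 0, and k^2 times the total mass 1. *)
Lemma powfun_fisher (R : realType) (theta beta : R) : 0 < theta -> 0 < beta ->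
  (forall i j : 'I_2,
     has_expectation powfun_density powfun_support (vec2 theta beta)
       (fun x => score powfun_density (vec2 theta beta) i x *
                 score powfun_density (vec2 theta beta) j x)) /\
  fisher_mx powfun_density powfun_support (vec2 theta beta) =
    diag_mx (vec2 (1 / theta ^+ 2) (theta ^+ 2 / beta ^+ 2)).
Proof.
move=> th0 b0.
have := @powfun_score_moments R _ _ th0 b0.
set s := fun x : R => theta^-1 + (ln x - ln beta).
set p := fun x : R => theta / x * expR (theta * (ln x - ln beta)).
move=> [[i0 i1 i2] [j0 j1 j2]].
pose k := - (theta / beta).
have mI : measurable (`]0, beta]%classic : set (measurableTypeR R)).
  exact: measurable_itv.
have S : powfun_support (vec2 theta beta) = `]0, beta]%classic.
  by rewrite /powfun_support vec2E1.
have pE x : (`]0, beta] : set R)%classic x -> powfun_density (vec2 theta beta) x = p x.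
  by rewrite /= in_itv/= => /andP[x0 _]; rewrite powfun_densityE ?vec2E0 ?vec2E1.
have s0E x : (`]0, beta] : set R)%classic x ->
    score powfun_density (vec2 theta beta) 0 x = s x.
  by rewrite /= in_itv/= => /andP[x0 _]; rewrite powfun_score0.
have s1E x : (`]0, beta] : set R)%classic x ->
    score powfun_density (vec2 theta beta) 1 x = k.
  by rewrite /= in_itv/= => /andP[x0 _]; rewrite powfun_score1.
have key (i j : 'I_2) (f : R -> R) :
    (forall x, (`]0, beta] : set R)%classic x ->
      score powfun_density (vec2 theta beta) i x *
      score powfun_density (vec2 theta beta) j x * p x = f x) ->
    lebesgue_measure.-integrable `]0, beta] (EFin \o f) ->
    has_expectation powfun_density powfun_support (vec2 theta beta)
      (fun x => score powfun_density (vec2 theta beta) i x *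
                score powfun_density (vec2 theta beta) j x) /\
    fisher_mx powfun_density powfun_support (vec2 theta beta) i j =
      \int[lebesgue_measure]_(x in `]0, beta]) f x.
  move=> fE fi; split.
    rewrite /has_expectation S; apply: eq_integrable fi => // x /set_mem xb.
    by rewrite /= pE// fE.
  rewrite /fisher_mx mxE /expectation_at S; apply: eq_Rintegral => x /set_mem xb.
  by rewrite pE// fE.
have [|E00 F00] := key 0 0 _ _ i2.
  by move=> x xb; rewrite s0E// expr2.
have i01 : lebesgue_measure.-integrable `]0, beta] (EFin \o (fun x => k * (s x * p x))).
  by have := integrableZl mI k i1.
have i11 : lebesgue_measure.-integrable `]0, beta] (EFin \o (fun x => k ^+ 2 * p x)).
  by have := integrableZl mI (k ^+ 2) i0.
have [|E01 F01] := key 0 1 _ _ i01.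
  by move=> x xb; rewrite s0E// s1E//; ring.
have [|E10 F10] := key 1 0 _ _ i01.
  by move=> x xb; rewrite s0E// s1E//; ring.
have [|E11 F11] := key 1 1 _ _ i11.
  by move=> x xb; rewrite s1E.
split; first by move=> i j; case: (ord2P i) (ord2P j) => -> [] ->.
apply/matrixP => i j; rewrite [RHS]mxE.
case: (ord2P i) (ord2P j) => -> [] ->.
- by rewrite F00 vec2E0 j2.
- by rewrite F01 RintegralZl// j1 mulr0.
- by rewrite F10 RintegralZl// j1 mulr0.
- by rewrite F11 RintegralZl// j0 vec2E1 mulr1 /k sqrrN expr_div_n.
Qed.

(** * The Fisher-Rao distance *)

(** The one-sided bound is used for [f] and [- f], whose derivatives have the same absolute
    value. *)
Lemma normr_le_integral_norm_derive1 (R : realType) (f : R -> R) (a b : R) (s : seq R) :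
  a <= b -> {within `[a, b], continuous f} ->
  (forall t, t \in `]a, b[ -> t \notin s -> derivable f t 1) ->
  (`|f b - f a|%:E <=
   \int[lebesgue_measure]_(t in `]a, b[ `\` [set` s]) `|derive1 f t|%:E)%E.
Proof.
move=> ab cf df.
have := le_integral_norm_derive1 ab cf df.
have : ((- f b - - f a)%:E <=
   \int[lebesgue_measure]_(t in `]a, b[ `\` [set` s]) `|derive1 f t|%:E)%E.
  have cNf : {within `[a, b], continuous (- f)}.
    by move=> x; apply: continuousN; exact: cf.
  have dNf t : t \in `]a, b[ -> t \notin s -> derivable (- f) t 1.
    by move=> abt st; apply: derivableN; exact: df.
  apply: le_trans (le_integral_norm_derive1 ab cNf dNf) _.
  rewrite le_eqVlt; apply/orP; left; apply/eqP; apply: eq_integral => t.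
  rewrite inE => -[abt st]; congr EFin.
  rewrite !derive1E deriveN ?normrN//; apply: df => //; exact/negP.
rewrite -opprD; by case: (ger0P (f b - f a)).
Qed.

Lemma fisher_quadratic_form (R : realType) (xi v : 'rV[R]_2) : powfun_param xi ->
  (v *m fisher_mx powfun_density powfun_support xi *m v^T) 0 0 =
  (v 0 0 / xi 0 0) ^+ 2 + (xi 0 0 / xi 0 1 * v 0 1) ^+ 2.
Proof.
move=> [t0 b0].
have -> : xi = vec2 (xi 0 0) (xi 0 1).
  by apply/rowP => i; rewrite mxE; case: (ord2P i) => ->.
rewrite (powfun_fisher t0 b0).2 mul_mx_diag mxE !big_ord_recl big_ord0 addr0.
have -> : lift ord0 ord0 = 1 :> 'I_2 by exact: val_inj.
rewrite !mxE/=; field; rewrite ?gt_eqF//.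
Qed.

Lemma continuous_ln_comp (R : realType) (F : set_system R) (x : R -> R) (l : R) :
  Filter F -> 0 < l -> x @ F --> l -> (fun u => ln (x u)) @ F --> ln l.
Proof. by move=> FF l0; apply: continuous_cvg => //; exact: continuous_ln. Qed.

Lemma is_derive_ln_comp (R : realType) (x : R -> R) (t x' : R) :
  0 < x t -> is_derive t 1 x x' -> is_derive t 1 (fun u => ln (x u)) (x' / x t).
Proof.
move=> x0 dx; rewrite mulrC.
by apply: (@is_derive1_comp R (@ln R) x) => //; exact: is_derive1_ln.
Qed.

Lemma is_derive_inv_comp (R : realType) (x : R -> R) (t x' : R) :
  x t != 0 -> is_derive t 1 x x' ->
  is_derive t 1 (fun u => (x u)^-1) (- (x' / x t ^+ 2)).
Proof.
move=> x0 [dx <-]; split; first exact: derivableV.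
by rewrite deriveV// /GRing.scale/= mulNr mulrC.
Qed.

(** * Lower bounds for lengths *)

Section Potential.
Context {R : realType}.

(* The functions whose gradient has norm at most 1 for the Fisher metric *)
Definition fisher_potential (Phi : R -> R -> R) :=
  (forall (F : set_system R) (x y : R -> R) (a b : R), Filter F -> 0 < a -> 0 < b ->
     x @ F --> a -> y @ F --> b -> (fun u => Phi (x u) (y u)) @ F --> Phi a b) /\
  (forall (x y : R -> R) (t x' y' : R), 0 < x t -> 0 < y t ->
     is_derive t 1 x x' -> is_derive t 1 y y' ->
     exists2 l, is_derive t 1 (fun u => Phi (x u) (y u)) l &
       l ^+ 2 <= (x' / x t) ^+ 2 + (x t / y t * y') ^+ 2).

(** Away from finitely many times, the derivative of [Phi] along the curve is bounded by the Fisher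
    speed; the increment inequality then integrates this bound. *)
Lemma fisher_potential_length (Phi : R -> R -> R) (xi1 xi2 : 'rV[R]_2) c :
  fisher_potential Phi -> curve_between powfun_param xi1 xi2 c ->
  (`|Phi (xi2 0 0) (xi2 0 1) - Phi (xi1 0 0) (xi1 0 1)|%:E <=
   fisher_length powfun_density powfun_support c)%E.
Proof.
move=> [cPhi dPhi] [pc cpos <- <-].
have [cc [s dc]] := piecewise_differentiable_continuous pc.
pose f t := Phi (c t 0 0) (c t 0 1).
have dcoord t i : t \in `]0, 1[ -> t \notin s ->
    is_derive t 1 (fun u => c u 0 i) (derive1 c t 0 i).
  move=> t01 ts; have dct := dc t t01 ts.
  have /derivable_mxP/(_ 0 i) dci := dct.
  by split => //; rewrite derive1E derive_mx// mxE.
have cf : {within `[0, 1], continuous f}.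
  apply/subspace_continuousP => t t01; have [x0 y0] := cpos t t01.
  have /subspace_continuousP/(_ _ t01) cct := cc.
  apply: cPhi => //.
    apply: (@cvg_comp _ _ _ c (fun M : 'rV[R]_2 => M 0 0) _ _ _ cct).
    exact: coord_continuous.
  apply: (@cvg_comp _ _ _ c (fun M : 'rV[R]_2 => M 0 1) _ _ _ cct).
  exact: coord_continuous.
have fD t : t \in `]0, 1[ -> t \notin s -> exists2 l, is_derive t 1 f l &
    l ^+ 2 <= (derive1 c t 0 0 / c t 0 0) ^+ 2 +
              (c t 0 0 / c t 0 1 * derive1 c t 0 1) ^+ 2.
  move=> t01 ts.
  have [x0 y0] : powfun_param (c t) by apply: cpos; exact: subset_itv_oo_cc.
  by apply: (dPhi (fun t => c t 0 0) (fun t => c t 0 1)) => //; exact: dcoord.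
have df t : t \in `]0, 1[ -> t \notin s -> derivable f t 1.
  by move=> t01 ts; have [l []] := fD t t01 ts.
apply: le_trans (normr_le_integral_norm_derive1 ler01 cf df) _.
apply: ge0_le_integralS.
- by move=> t [+ _]; exact: subset_itv_oo_cc.
- by move=> t _; rewrite lee_fin.
- by move=> t _; rewrite lee_fin sqrtr_ge0.
- move=> t [t01 /negP ts]; have [l dl lle] := fD t t01 ts.
  rewrite lee_fin fisher_quadratic_form; last first.
    by apply: cpos; exact: subset_itv_oo_cc.
  have -> : derive1 f t = l by rewrite derive1E; case: dl.
  by rewrite -sqrtr_sqr ler_wsqrtr.
Qed.

(** In the half plane this is minus the logarithm of the height 1 / theta, the potential adapted to
    vertical geodesics. *)
Lemma fisher_potential_ln : fisher_potential (fun theta _ => ln theta).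
Proof.
split=> [F x y a b FF a0 b0 xa yb|x y t x' y' x0 y0 dx dy].
  exact: continuous_ln_comp.
exists (x' / x t); first exact: is_derive_ln_comp.
by rewrite lerDl sqr_ge0.
Qed.

(** With w = ln beta - xi and y = 1 / theta the argument of the logarithm is (w^2 + y^2) / y: this
    is the Busemann function of the boundary point [xi], up to sign. *)
Lemma fisher_potential_busemann (xi : R) : fisher_potential
  (fun theta beta => ln (theta * (ln beta - xi) ^+ 2 + theta^-1)).
Proof.
have pos (th w : R) : 0 < th -> 0 < th * w ^+ 2 + th^-1.
  by move=> th0; rewrite ltr_wpDl ?invr_gt0// mulr_ge0 ?sqr_ge0// ltW.
split=> [F x y a b FF a0 b0 xa yb|x y t x' y' x0 y0 dx dy].
  apply: continuous_ln_comp; first exact: pos.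
  apply: cvgD; last by apply: cvgV; rewrite ?gt_eqF.
  have yl : (fun u => ln (y u) - xi) @ F --> ln b - xi.
    by apply: cvgB; [exact: continuous_ln_comp|exact: cvg_cst].
  by apply: cvgM => //; rewrite expr2; apply: cvgM.
have dw : is_derive t 1 (fun u => ln (y u) - xi) (y' / y t).
  have dly := is_derive_ln_comp y0 dy.
  by apply: is_derive_eq; rewrite subr0.
have dV := is_derive_inv_comp (lt0r_neq0 x0) dx.
set w := ln (y t) - xi.
have xt : x t != 0 by rewrite gt_eqF.
have yt : y t != 0 by rewrite gt_eqF.
set P := fun u => x u * (ln (y u) - xi) ^+ 2 + (x u)^-1.
pose P' := x' * w ^+ 2 + x t * (2 * w * (y' / y t)) - x' / x t ^+ 2.
have P0 : 0 < P t by exact: pos.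
have dP : is_derive t 1 P P'.
  rewrite /P; apply: is_derive_eq; rewrite /P' -/w /GRing.scale/=.
  by field; rewrite xt yt.
have dl : is_derive t 1 (fun u => ln (P u)) (P' / P t) by exact: is_derive_ln_comp.
exists (P' / P t) => //.
rewrite expr_div_n ler_pdivrMr ?exprn_gt0//.
(* Cauchy-Schwarz: [P ^+ 2] is the sum of the squares of the coefficients of
   [A] and [B]. *)
set A := x' / x t; set B := x t / y t * y'.
have -> : P' = A * (x t * w ^+ 2 - (x t)^-1) + B * (2 * w).
  by rewrite /P' /A /B; field; rewrite xt yt.
have -> : P t ^+ 2 = (x t * w ^+ 2 - (x t)^-1) ^+ 2 + (2 * w) ^+ 2.
  by rewrite /P -/w; field.
set C := _ - _; set D := 2 * w.
have -> : (A ^+ 2 + B ^+ 2) * (C ^+ 2 + D ^+ 2) =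
    (A * C + B * D) ^+ 2 + (A * D - B * C) ^+ 2 by ring.
by rewrite lerDl sqr_ge0.
Qed.

End Potential.

(** * Explicit curves and vertical geodesics *)

Lemma derivable_differentiable_on_itv (R : realType) (d : nat) (a b : R)
    (c : R -> 'rV[R]_d) :
  (forall t, derivable c t 1) -> differentiable_on_itv a b c.
Proof.
move=> dc t _; have /cvg_ex[/= l cl] := dc t.
apply/cvg_ex; exists l; apply: cvg_within_filter.
apply/cvgrPdist_le => e e0; have /cvgrPdist_le/(_ e e0) := cl.
rewrite !near_withinE => /nbhs_ballP[r /= r0 rP].
apply/nbhs_ballP; exists r => //= u; rewrite /ball/= => tu ut.
have := rP (u - t); rewrite /ball/= sub0r opprB subr_eq0 => /(_ tu ut).
by rewrite /GRing.scale/= mulr1 subrK.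
Qed.

(** A curve of constant speed [|K|] on the unit interval has length [|K|]; smooth on the whole line,
    it forms a single piece. *)
Lemma fisher_rao_dist_le (R : realType) (X Y X' Y' : R -> R) (K : R) :
  (forall t, 0 < X t) -> (forall t, 0 < Y t) ->
  (forall t : R, is_derive t 1 X (X' t)) -> (forall t : R, is_derive t 1 Y (Y' t)) ->
  (forall t, (X' t / X t) ^+ 2 + (X t / Y t * Y' t) ^+ 2 = K ^+ 2) ->
  (fisher_rao_dist powfun_density powfun_support powfun_param
     (vec2 (X 0%R) (Y 0%R)) (vec2 (X 1%R) (Y 1%R)) <= `|K|%:E)%E.
Proof.
move=> X0 Y0 dX dY speed.
pose c t := vec2 (X t) (Y t).
have dc t : derivable c t 1.
  apply/derivable_mxP => i j; rewrite [i]ord1; case: (ord2P j) => ->.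
    have -> : (fun u => c u 0 0) = X by apply/funext => u; exact: vec2E0.
    by have [] := dX t.
  have -> : (fun u => c u 0 1) = Y by apply/funext => u; exact: vec2E1.
  by have [] := dY t.
have dc0 t : derive1 c t 0 0 = X' t.
  rewrite derive1E derive_mx// mxE.
  have -> : (fun u => c u 0 0) = X by apply/funext => u; exact: vec2E0.
  by have [] := dX t.
have dc1 t : derive1 c t 0 1 = Y' t.
  rewrite derive1E derive_mx// mxE.
  have -> : (fun u => c u 0 1) = Y by apply/funext => u; exact: vec2E1.
  by have [] := dY t.
have cpos t : powfun_param (c t) by split; rewrite ?vec2E0 ?vec2E1.
apply: ereal_inf_lbound; exists c.
  split => //; exists [:: 1]; first exact: itv_partition1.
  by case=> // _; exact: derivable_differentiable_on_itv.
rewrite /fisher_length.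
under eq_integral => t _.
  rewrite fisher_quadratic_form// dc0 dc1 vec2E0 vec2E1 speed sqrtr_sqr; over.
rewrite integral_cst//= lebesgue_measure_itv/= lte_fin ltr01.
by rewrite sube0 mule1.
Qed.

(** The quotient (b - a) / (b + a) is tanh (ln (b / a) / 2). *)
Lemma double_arctanh_sqrt (R : realType) (a b : R) : 0 < a -> 0 < b ->
  2 * arctanh (Num.sqrt (((b - a) / (b + a)) ^+ 2)) = `|ln b - ln a|.
Proof.
move=> a0 b0; rewrite sqrtr_sqr /arctanh mulrC divfK ?pnatr_eq0//.
wlog ab : a b a0 b0 / a <= b.
  move=> H; case: (leP a b) => [|/ltW] ab; first exact: H.
  by rewrite distrC -H// -normrN -mulNr opprB [a + b]addrC.
rewrite !ger0_norm; last 2 first.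
- by rewrite subr_ge0 ler_ln ?posrE.
- by rewrite divr_ge0 ?subr_ge0// addr_ge0// ltW.
rewrite -ln_div ?posrE//; congr ln; field.
have -> : b + a - (b - a) = 2 * a by ring.
by rewrite mulf_neq0 ?pnatr_eq0 ?gt_eqF ?addr_gt0.
Qed.

Lemma fisher_rao_dist_ge (R : realType) (Phi : R -> R -> R) (xi1 xi2 : 'rV[R]_2) :
  fisher_potential Phi ->
  (`|Phi (xi2 0 0) (xi2 0 1) - Phi (xi1 0 0) (xi1 0 1)|%:E <=
   fisher_rao_dist powfun_density powfun_support powfun_param xi1 xi2)%E.
Proof.
move=> pPhi; apply: le_ereal_inf_tmp => _ [c cc <-].
exact: fisher_potential_length pPhi cc.
Qed.

Lemma fisher_rao_dist_vertical (R : realType) (theta1 theta2 beta : R) :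
  0 < theta1 -> 0 < theta2 -> 0 < beta ->
  fisher_rao_dist powfun_density powfun_support powfun_param
    (vec2 theta1 beta) (vec2 theta2 beta) = `|ln theta2 - ln theta1|%:E.
Proof.
move=> th1 th2 b0; set tau := ln theta2 - ln theta1.
apply/eqP; rewrite eq_le; apply/andP; split; last first.
  have := fisher_rao_dist_ge (vec2 theta1 beta) (vec2 theta2 beta)
    (@fisher_potential_ln R).
  by rewrite !vec2E0.
pose X t := theta1 * expR (tau * t).
have X0 t : 0 < X t by rewrite mulr_gt0 ?expR_gt0.
have dX (t : R) : is_derive t 1 X (tau * X t).
  have dE : is_derive t 1 (fun t => expR (tau * t)) (expR (tau * t) * tau).
    apply: is_derive1_comp.
    by apply: is_derive_eq; rewrite /GRing.scale/= mulr1.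
  by apply: is_derive_eq; rewrite /GRing.scale/= /X; ring.
have X_0 : X 0 = theta1 by rewrite /X mulr0 expR0 mulr1.
have X_1 : X 1 = theta2.
  rewrite /X mulr1 expRD expRN !lnK ?posrE// mulrCA mulfV ?gt_eqF// mulr1//.
rewrite -{1}X_0 -{1}X_1.
apply: (@fisher_rao_dist_le R X (fun=> beta) (fun t => tau * X t) (fun=> 0)) => // t.
by rewrite mulr0 expr0n addr0 mulfK ?gt_eqF.
Qed.

(** * Half circles and the closed formula *)

Section Geodesic.
Context {R : realType}.
Variables (xi k : R).
Hypothesis k0 : 0 < k.

(* The half circle of the upper half plane (ln beta, 1 / theta) with end points
   [xi] and [xi + k], in the parameter exp(arc length) *)
Definition geodesic_theta (E : R) : R := (E + E^-1) / k.
Definition geodesic_beta (E : R) : R := expR (xi + k * (1 - (1 + E ^+ 2)^-1)).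

Lemma geodesic_theta_gt0 E : 0 < E -> 0 < geodesic_theta E.
Proof. by move=> E0; rewrite divr_gt0// addr_gt0 ?invr_gt0. Qed.

(** On the half circle, w = ln beta - xi and y = 1 / theta satisfy w^2 + y^2 = k w and w / y = E.
    Hence the Busemann function of [xi] is ln k + ln E there, and its variation equals the length of
    the arc. *)
Lemma fisher_rao_dist_geodesic (E1 E2 : R) : 0 < E1 -> 0 < E2 ->
  fisher_rao_dist powfun_density powfun_support powfun_param
    (vec2 (geodesic_theta E1) (geodesic_beta E1))
    (vec2 (geodesic_theta E2) (geodesic_beta E2)) = `|ln E2 - ln E1|%:E.
Proof.
move=> E10 E20; set tau := ln E2 - ln E1.
have sq1 (E : R) : 0 < 1 + E ^+ 2 by rewrite ltr_wpDr ?sqr_ge0.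
apply/eqP; rewrite eq_le; apply/andP; split; last first.
  have := fisher_rao_dist_ge (vec2 (geodesic_theta E1) (geodesic_beta E1))
    (vec2 (geodesic_theta E2) (geodesic_beta E2)) (@fisher_potential_busemann R xi).
  have PhiE E : 0 < E ->
      ln (geodesic_theta E * (ln (geodesic_beta E) - xi) ^+ 2 + (geodesic_theta E)^-1)
      = ln k + ln E.
    move=> E0; rewrite /geodesic_beta expRK -lnM ?posrE//; congr ln.
    rewrite /geodesic_theta; field.
    by rewrite -expr2 [_ + 1]addrC !gt_eqF.
  by rewrite !vec2E0 !vec2E1 !PhiE// opprD addrACA subrr add0r.
(* Geometric interpolation of the parameter, so that the arc is run through at constant speed
   [|tau|]. *)
pose E t := E1 * expR (tau * t).
have E0 t : 0 < E t by rewrite mulr_gt0 ?expR_gt0.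
have dE (t : R) : is_derive t 1 E (tau * E t).
  have dexp : is_derive t 1 (fun t => expR (tau * t)) (expR (tau * t) * tau).
    apply: is_derive1_comp.
    by apply: is_derive_eq; rewrite /GRing.scale/= mulr1.
  by apply: is_derive_eq; rewrite /GRing.scale/= /E; ring.
have dX (t : R) : is_derive t 1 (fun t => geodesic_theta (E t))
    (tau * (E t - (E t)^-1) / k).
  have dV := is_derive_inv_comp (lt0r_neq0 (E0 t)) (dE t).
  rewrite /geodesic_theta; apply: is_derive_eq; rewrite /GRing.scale/=.
  by field; rewrite !gt_eqF.
have dY (t : R) : is_derive t 1 (fun t => geodesic_beta (E t))
    (geodesic_beta (E t) * (2 * k * tau * E t ^+ 2 / (1 + E t ^+ 2) ^+ 2)).
  rewrite /geodesic_beta.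
  apply: (@is_derive1_comp R expR (fun t => xi + k * (1 - (1 + E t ^+ 2)^-1))).
  have dS : is_derive t 1 (fun t => 1 + E t ^+ 2) (2 * tau * E t ^+ 2).
    by apply: is_derive_eq; rewrite /GRing.scale/=; ring.
  have dV := is_derive_inv_comp (x := fun t => 1 + E t ^+ 2)
    (lt0r_neq0 (sq1 (E t))) dS.
  apply: is_derive_eq; rewrite /GRing.scale/=; ring.
have E_0 : E 0 = E1 by rewrite /E mulr0 expR0 mulr1.
have E_1 : E 1 = E2.
  by rewrite /E mulr1 expRD expRN !lnK ?posrE// mulrCA mulfV ?gt_eqF// mulr1.
rewrite -{1 2}E_0 -{1 2}E_1.
apply: fisher_rao_dist_le dX dY _ => t.
- exact: geodesic_theta_gt0.
- exact: expR_gt0.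
rewrite mulrA divfK ?gt_eqF ?expR_gt0// /geodesic_theta; field.
by rewrite !gt_eqF.
Qed.

End Geodesic.

(** The centre [c] is the boundary point equidistant from the two points (ln beta, 1 / theta), which
    exists as their abscissas differ. With radius [r], the left end is c - r, the diameter 2 r, and
    the parameter of a point is (ln beta - (c - r)) theta. *)
Lemma geodesic_through (R : realType) (theta1 beta1 theta2 beta2 : R) :
  0 < theta1 -> 0 < beta1 -> 0 < theta2 -> 0 < beta2 -> beta1 != beta2 ->
  exists xi k E1 E2 : R, [/\ 0 < k, 0 < E1, 0 < E2,
    theta1 = geodesic_theta k E1 /\ beta1 = geodesic_beta xi k E1 &
    theta2 = geodesic_theta k E2 /\ beta2 = geodesic_beta xi k E2].
Proof.
move=> t10 b10 t20 b20 b12.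
pose w1 := ln beta1; pose w2 := ln beta2.
have w12 : w2 - w1 != 0.
  by rewrite subr_eq0; apply: contra b12 => /eqP/ln_inj ->.
pose c := ((w2 ^+ 2 + theta2 ^- 2) - (w1 ^+ 2 + theta1 ^- 2)) / (2 * (w2 - w1)).
pose r2 := (w1 - c) ^+ 2 + theta1 ^- 2.
have r2E : r2 = (w2 - c) ^+ 2 + theta2 ^- 2.
  by rewrite /r2 /c; field; rewrite w12 !gt_eqF.
pose r := Num.sqrt r2.
have r20 : 0 < r2 by rewrite ltr_wpDl ?sqr_ge0// invr_gt0 exprn_gt0.
have r0 : 0 < r by rewrite sqrtr_gt0.
have rE : r ^+ 2 = r2 by rewrite sqr_sqrtr// ltW.
have key theta beta : 0 < theta -> 0 < beta ->
    r ^+ 2 = (ln beta - c) ^+ 2 + theta ^- 2 ->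
    let E := theta * (ln beta - (c - r)) in [/\ 0 < E,
      theta = geodesic_theta (2 * r) E & beta = geodesic_beta (c - r) (2 * r) E].
  move=> t0 b0 circle E.
  set D := ln beta - (c - r) in E *.
  have tn : theta != 0 by rewrite gt_eqF.
  (* The equation of the circle with the origin moved to its left end; it forces [D] to be
     positive. *)
  have circleD : D ^+ 2 + theta ^- 2 = 2 * r * D.
    have -> : D = (ln beta - c) + r by rewrite /D; ring.
    have -> : theta ^- 2 = r ^+ 2 - (ln beta - c) ^+ 2 by rewrite circle; ring.
    ring.
  have D0 : 0 < D.
    have : 0 < 2 * r * D.
      by rewrite -circleD ltr_wpDl ?sqr_ge0// invr_gt0 exprn_gt0.
    by rewrite pmulr_rgt0// mulr_gt0.
  have E0 : 0 < E by rewrite mulr_gt0.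
  have E2 : 1 + E ^+ 2 = theta ^+ 2 * (2 * r * D).
    by rewrite -circleD /E; field.
  split => //.
    rewrite /geodesic_theta.
    have -> : E + E^-1 = (1 + E ^+ 2) / E by field; rewrite gt_eqF.
    by rewrite E2 /E; field; rewrite !gt_eqF.
  rewrite /geodesic_beta -[LHS]lnK ?posrE//; congr expR.
  have -> : 1 - (1 + E ^+ 2)^-1 = E ^+ 2 / (1 + E ^+ 2).
    by field; rewrite gt_eqF// ltr_wpDr ?sqr_ge0.
  by rewrite E2 /E /D; field; rewrite -/D !gt_eqF.
have [|E10 t1 b1] := key _ _ t10 b10; first by rewrite rE.
have [|E20 t2 b2] := key _ _ t20 b20; first by rewrite rE r2E.
exists (c - r), (2 * r), (theta1 * (ln beta1 - (c - r))), (theta2 * (ln beta2 - (c - r))).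
by split => //; rewrite mulr_gt0.
Qed.

Lemma geodesic_ratio (R : realType) (xi k E1 E2 : R) : 0 < k -> 0 < E1 -> 0 < E2 ->
  let theta1 := geodesic_theta k E1 in let theta2 := geodesic_theta k E2 in
  let T := theta1 * theta2 * ln (geodesic_beta xi k E1 / geodesic_beta xi k E2) in
  (T ^+ 2 + (theta1 - theta2) ^+ 2) / (T ^+ 2 + (theta1 + theta2) ^+ 2) =
  ((E2 - E1) / (E2 + E1)) ^+ 2.
Proof.
move=> k0 E10 E20 theta1 theta2 T.
have sq1 (E : R) : 0 < 1 + E ^+ 2 by rewrite ltr_wpDr ?sqr_ge0.
have n1 := lt0r_neq0 (sq1 E1); have n2 := lt0r_neq0 (sq1 E2).
have n3 := lt0r_neq0 E10; have n4 := lt0r_neq0 E20; have n5 := lt0r_neq0 k0.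
have n6 := lt0r_neq0 (addr_gt0 E20 E10).
have TE : T = (E1 ^+ 2 - E2 ^+ 2) / (k * E1 * E2).
  rewrite /T ln_div ?posrE ?expR_gt0// !expRK /theta1 /theta2 /geodesic_theta.
  by field; rewrite n1 n2 n3 n4 n5.
(* The common factor of numerator and denominator, by (E1 + E2)^2 + (E1 E2 - 1)^2 = (1 + E1^2) (1 +
   E2^2) and the same identity with both signs reversed. *)
pose C := (1 + E1 ^+ 2) * (1 + E2 ^+ 2) / (k * E1 * E2) ^+ 2.
have C0 : C != 0 by rewrite mulf_neq0 ?mulf_neq0 ?invr_eq0 ?expf_neq0 ?mulf_neq0.
have -> : T ^+ 2 + (theta1 - theta2) ^+ 2 = (E2 - E1) ^+ 2 * C.
  by rewrite TE /C /theta1 /theta2 /geodesic_theta; field; rewrite n3 n4 n5.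
have -> : T ^+ 2 + (theta1 + theta2) ^+ 2 = (E2 + E1) ^+ 2 * C.
  by rewrite TE /C /theta1 /theta2 /geodesic_theta; field; rewrite n3 n4 n5.
by rewrite expr_div_n; field; rewrite n6 C0.
Qed.

Theorem mainTheorem6 (R : realType) :
  (forall theta beta : R, 0 < theta -> 0 < beta ->
     (forall i j : 'I_2,
        has_expectation powfun_density powfun_support (vec2 theta beta)
          (fun x => score powfun_density (vec2 theta beta) i x *
                    score powfun_density (vec2 theta beta) j x)) /\
     fisher_mx powfun_density powfun_support (vec2 theta beta) =
       diag_mx (vec2 (1 / theta ^+ 2) (theta ^+ 2 / beta ^+ 2))) /\
  (forall theta1 beta1 theta2 beta2 : R,
     0 < theta1 -> 0 < beta1 -> 0 < theta2 -> 0 < beta2 ->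
     fisher_rao_dist powfun_density powfun_support powfun_param
       (vec2 theta1 beta1) (vec2 theta2 beta2) =
     (2 * arctanh (Num.sqrt
        (((theta1 * theta2 * ln (beta1 / beta2)) ^+ 2 + (theta1 - theta2) ^+ 2) /
         ((theta1 * theta2 * ln (beta1 / beta2)) ^+ 2 + (theta1 + theta2) ^+ 2))))%:E).
Proof.
split=> [theta beta th0 b0|theta1 beta1 theta2 beta2 t10 b10 t20 b20].
  exact: powfun_fisher.
(* Equal values of beta give a vertical geodesic: the logarithm vanishes and the ratio is the square
   of (theta1 - theta2) / (theta1 + theta2). Otherwise a half circle joins the points. *)
have [b12|b12] := eqVneq beta1 beta2.
  rewrite -b12 fisher_rao_dist_vertical// -double_arctanh_sqrt//.
  rewrite divff ?gt_eqF// ln1 mulr0 expr0n/= !add0r -expr_div_n.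
  by rewrite -sqrrN -mulNr opprB [theta2 + _]addrC.
have [xi [k [E1 [E2 [k0 E10 E20 [-> ->] [-> ->]]]]]] :=
  geodesic_through t10 b10 t20 b20 b12.
by rewrite geodesic_ratio// double_arctanh_sqrt// fisher_rao_dist_geodesic.
Qed.
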